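(* Let $(X,\mathrm{d},\mathfrak{m})$ be a metric measure space with non-negative synthetic Ricci curvature, i.e. satisfying the $\mathrm{CD}(0,\infty)$ condition, and let $h(X,\mathrm{d},\mathfrak{m})$ denote its volume entropy. Then for every Borel set $\Omega\subset X$ with $\mathfrak{m}(\Omega)<+\infty$, $$\mathfrak{m}^+(\Omega)\;\geq\; \mathfrak{m}(\Omega)\, h(X,\mathrm{d},\mathfrak{m}).$$ Moreover, the constant $h(X,\mathrm{d},\mathfrak{m})$ in this inequality cannot be replaced by any larger one: for every real number $C>h(X,\mathrm{d},\mathfrak{m})$, it is not true that $\mathfrak{m}^+(\Omega)\geq C\,\mathfrak{m}(\Omega)$ holds for all Borel sets $\Omega\subset X$ with $\mathfrak{m}(\Omega)<+\infty$.
   Context: Metric measure space: a triple $(X,\mathrm{d},\mathfrak{m})$ where $(X,\mathrm{d})$ is a complete separable metric space and $\mathfrak{m}$ is a non-negative Borel measure with full support that is finite on bounded sets (so every open ball of positive radius has positive finite measure). Minkowski content: for a Borel set $Z\subset X$ with $\mathfrak{m}(Z)<+\infty$, $$\mathfrak{m}^+(Z):=\liminf_{\epsilon\to 0^+}\frac{\mathfrak{m}(Z^\epsilon)-\mathfrak{m}(Z)}{\epsilon},\qquad Z^\epsilon:=\{x\in X:\ \mathrm{d}(x,Z)<\epsilon\}.$$ $\mathrm{CD}(0,\infty)$ condition (non-negative Ricci curvature in the sense of Lott–Sturm–Villani): let $\mathcal{P}_2(X)$ be the set of Borel probability measures on $X$ with finite second moment, with the $L^2$-Wasserstein distance $W_2$.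 For $\mu\in\mathcal{P}_2(X)$, let $\mathrm{Ent}_{\mathfrak{m}}(\mu):=\int\rho\ln\rho\,\mathrm{d}\mathfrak{m}$ if $\mu=\rho\,\mathfrak{m}$, and $\mathrm{Ent}_{\mathfrak{m}}(\mu):=+\infty$ otherwise. The space satisfies $\mathrm{CD}(0,\infty)$ if for any $\mu_0,\mu_1\in\mathcal{P}_2(X)$ with $\mu_0,\mu_1\ll\mathfrak{m}$ there is an $L^2$-Wasserstein geodesic $(\mu_t)_{t\in[0,1]}$ from $\mu_0$ to $\mu_1$ such that for all $t\in[0,1]$ $$\mathrm{Ent}_{\mathfrak{m}}(\mu_t)\leq t\,\mathrm{Ent}_{\mathfrak{m}}(\mu_1)+(1-t)\,\mathrm{Ent}_{\mathfrak{m}}(\mu_0).$$ Volume entropy: for $x_0\in X$, $$h(X,\mathrm{d},\mathfrak{m})(x_0):=\lim_{r\to+\infty}\frac{\ln \mathfrak{m}(B_r(x_0))}{r}\in[0,\infty],$$ where $B_r(x_0)$ is the ball of radius $r$ centred at $x_0$. For spaces satisfying $\mathrm{CD}(0,\infty)$ this limit exists and does not depend on $x_0$, and is denoted $h(X,\mathrm{d},\mathfrak{m})$. *)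

(* Defs.v *)
From HB Require Import structures.
From mathcomp Require Import all_boot all_order all_algebra.
From mathcomp Require Import all_classical all_reals all_analysis.

Set Implicit Arguments.
Unset Strict Implicit.
Unset Printing Implicit Defensive.
Import Order.TTheory GRing.Theory Num.Theory.
Import numFieldNormedType.Exports.
Local Open Scope classical_set_scope.
Local Open Scope ring_scope.
Local Open Scope ereal_scope.

(* [Complete] includes [Pointed], so the spaces below are nonempty. *)
#[short(type="completeMetricType")]
HB.structure Definition CompleteMetric (R : numDomainType) :=
  {T of Metric R T & Complete T}.

Notation borel X := (g_sigma_algebraType (@open X)).

Lemma edistE (R : realType) (X : metricType R) (x y : X) :
  edist (x, y) = (mdist x y)%:E.
Proof.
apply/eqP; rewrite eq_le; apply/andP; split.
- apply/lee_addgt0Pr => e e0; rewrite -EFinD; apply: edist_fin => //=.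
    by rewrite ltr_wpDl// mdist_ge0.
  by rewrite ballEmdist /= ltrDl.
- apply: le_ereal_inf_tmp => _ [r [_ /= +] <-].
  by rewrite ballEmdist lee_fin; exact: ltW.
Qed.

Section metric_measure_space.
Context {R : realType} (X : completeMetricType R).
Implicit Types (m : {measure set (borel X) -> \bar R}).
Implicit Types (mu nu : probability (borel X) R).

Definition separable_space : Prop :=
  exists2 D : set X, countable D & dense D.

Definition full_support m : Prop :=
  forall U : set X, open U -> U !=set0 -> 0 < m U.

Definition finite_on_bounded m : Prop :=
  forall B : set (borel X), measurable B ->
    (exists (x : X) (r : R), B `<=` ball x r) -> m B < +oo.

Definition is_metric_measure_space m : Prop :=
  [/\ separable_space, full_support m & finite_on_bounded m].

Definition enlargement (Z : set X) (e : R) : set X :=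
  [set x | edist_inf Z x < e%:E].

Definition minkowski_content m (Z : set X) : \bar R :=
  limf_einf (fun e : R => (m (enlargement Z e) - m Z) / e%:E) 0^'+.

(* [X] is nonempty, and finiteness does not depend on the base point. *)
Definition finite_second_moment mu : Prop :=
  exists x0 : X, \int[mu]_x ((mdist x0 x) ^+ 2)%:E < +oo.

Definition is_coupling mu nu
    (g : probability (borel X * borel X)%type R) : Prop :=
  forall A : set (borel X), measurable A ->
    pushforward g fst A = mu A /\ pushforward g snd A = nu A.

Definition W2 mu nu : \bar R :=
  sqrte (ereal_inf [set \int[g]_p ((mdist (p.1 : X) p.2) ^+ 2)%:E
                   | g in is_coupling mu nu]).

(* Only the values of [mu_] on [0, 1] matter. *)
Definition W2_geodesic (mu_ : R -> probability (borel X) R) mu0 mu1 : Prop :=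
  [/\ forall t : R, (0 <= t <= 1)%R -> finite_second_moment (mu_ t),
      mu_ 0%R = mu0, mu_ 1%R = mu1 &
      forall s t : R, (0 <= s <= 1)%R -> (0 <= t <= 1)%R ->
        W2 (mu_ s) (mu_ t) = `|t - s|%R%:E * W2 mu0 mu1].

Definition is_density m mu (rho : borel X -> R) : Prop :=
  [/\ measurable_fun setT rho, (forall x, 0 <= rho x)%R &
      forall A : set (borel X), measurable A ->
        mu A = \int[m]_(x in A) (rho x)%:E].

(* The integral of [rho ln rho], with value [+oo] when the positive part is not
   integrable: this is what dual addition [-%dE] gives for [+oo - +oo]. Note
   that [0 * ln 0 = 0]. *)
Definition int_rho_ln_rho m (rho : borel X -> R) : \bar R :=
  let f := fun x => (rho x * ln (rho x))%R%:E in
  (\int[m]_x f^\+ x - \int[m]_x f^\- x)%dE.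

(* The value does not depend on the chosen density, as densities of [mu] agree
   [m]-almost everywhere. *)
Definition Ent m mu : \bar R :=
  if pselect (exists rho, is_density m mu rho) is left h
  then int_rho_ln_rho m (sval (cid h)) else +oo.

(* Dual addition makes the inequality void in the case [+oo + -oo]. *)
Definition CD0oo m : Prop :=
  forall mu0 mu1, finite_second_moment mu0 -> finite_second_moment mu1 ->
    mu0 `<< m -> mu1 `<< m ->
    exists2 mu_ : R -> probability (borel X) R, W2_geodesic mu_ mu0 mu1 &
      forall t : R, (0 <= t <= 1)%R ->
        Ent m (mu_ t) <= (t%:E * Ent m mu1 + (1 - t)%R%:E * Ent m mu0)%dE.

Definition volume_entropy m (x0 : X) : \bar R :=
  lim (lne (m (ball x0 r)) / r%:E @[r --> +oo%R]).

End metric_measure_space.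

(* Main.v *)
From HB Require Import structures.
Require Import Defs.
From mathcomp Require Import all_boot all_order all_algebra.
From mathcomp Require Import all_classical all_reals all_analysis.
From mathcomp Require Import measurable_realfun.
From mathcomp Require Import ring lra.

Set Implicit Arguments.
Unset Strict Implicit.
Unset Printing Implicit Defensive.
Import Order.TTheory GRing.Theory Num.Theory.
Import numFieldNormedType.Exports.
Local Open Scope classical_set_scope.
Local Open Scope ring_scope.
Local Open Scope ereal_scope.

(** Write v(r) for the logarithm of the mass of the ball B_r of centre x0 and
    radius r, and A^e for the open e-enlargement of A.

    The heart of the proof is a Brunn-Minkowski inequality. Let A and B be
    bounded sets of positive mass, with d(x, z) <= D for x in A and z in B, and
    let t D < e with 0 < t < 1. Join the uniform distribution on A to the one on
    B by a Wasserstein geodesic given by CD(0, oo). Its time-t measure is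
    concentrated on A^e ([interpolant_concentration]), so by Jensen's inequality
    its entropy is at least - ln m(A^e) ([jensen_entropy]), whereas the entropies
    of the endpoints are - ln m(A) and - ln m(B) ([uniform_on_Ent]). Convexity of
    the entropy gives
      (1 - t) ln m(A) + t ln m(B) <= ln m(A^e)   ([CD0oo_brunn_minkowski]).

    The concentration property needs neither optimal plans nor a lift of the
    geodesic to a measure on paths. Almost optimal couplings of (mu_0, mu_t) and
    of (mu_t, mu_1) are glued along mu_t up to a small error d: cut the space
    into countably many Borel pieces of small diameter and make the couplings
    conditionally independent given the piece ([approximate_gluing]). This yields
    random points x, y, y', z with d(y, y') < d. With a = d(x, y), b = d(y', z)
    and c = d(x, z), completing squares turns c <= a + b + d into
      c^2 + (a - t c)^2 <= a^2 / t + b^2 / (1 - t) + 2 D d,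
    and the integral of c^2 is at least W2(mu_0, mu_1)^2 while that of the first
    two terms on the right exceeds it by at most O(d). Hence a is close to t c, and
    points y at distance at least e from A carry no mass.

    With B = B_r and r -> +oo, the inequality says that ln m(A^e) - ln m(A) is at
    least e times the exponential growth rate of the balls. For A = B_1 this
    forces v(r) / r to converge to a finite limit h ([growth_rate]), so that h is
    the volume entropy; in general it gives m(A^e) >= (1 + e h) m(A), hence the
    isoperimetric inequality, first for bounded A and then for every Borel A by
    monotone approximation ([enlargement_growth]).

    Conversely, if the inequality held with some C > h, then applying it to balls
    would bound the lower right Dini derivative of v from below by C, so v would
    grow at least linearly with a slope larger than h
    ([minkowski_content_ball_lower]), which is absurd. *)

(** * Borel sets and distances in a separable metric space *)

Section metric_measurability.
Context {R : realType} (X : completeMetricType R).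
Implicit Types (x y : X) (r : R).

Lemma mem_ballE x r y : ball x r y = (mdist x y < r)%R :> Prop.
Proof. by rewrite ballEmdist. Qed.

Lemma open_mball x r : open (ball x r).
Proof.
rewrite openE => y; rewrite mem_ballE => xy.
rewrite /interior -nbhs_ballE; exists (r - mdist x y)%R => /=.
  by rewrite subr_gt0.
move=> z; rewrite !mem_ballE => yz.
by rewrite (le_lt_trans (metric_triangle x y z))// -ltrBrDl.
Qed.

Lemma open_borel (U : set X) : open U -> measurable (U : set (borel X)).
Proof. exact: sub_sigma_algebra. Qed.

Lemma measurable_mball x r : measurable (ball x r : set (borel X)).
Proof. by apply: open_borel; exact: open_mball. Qed.

Lemma dense_sequence : separable_space X ->
  exists q : nat -> X, forall x r, (0 < r)%R -> exists n, (mdist (q n) x < r)%R.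
Proof.
move=> [D cD dD].
have [q qD] : exists q : nat -> X, D `<=` range q.
  by move: cD => /pcard_surjP[f sf]; exists f => y /sf.
exists q => x r r0.
have [] := dD (ball x r); [by exists x; exact: ballxx|exact: open_mball|].
move=> y [/= xy /qD[n _ qny]]; exists n; rewrite qny metric_sym.
by rewrite mem_ballE in xy.
Qed.

(** Separability is what makes the distance measurable for the product of the
    Borel sigma-algebras: the set of pairs at distance less than r is a countable
    union of products of balls. *)
Lemma measurable_fun_mdist : separable_space X ->
  measurable_fun setT
    (fun p : (borel X * borel X)%type => mdist (p.1 : X) (p.2 : X)).
Proof.
move=> /dense_sequence[q qP].
apply: (measurability _ (measurable_realfun.RGenInftyO.measurableE R)) => _ [_ [r ->] <-].
rewrite setTI.
rewrite [X in measurable X](_ : _ = \bigcup_n \bigcup_(s : rat)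
    (((ball (q n) (ratr s)) : set (borel X)) `*`
     ((ball (q n) (r - ratr s)%R) : set (borel X)))); last first.
  apply/seteqP; split => [[x y]/=|[x y] [n _ [s _ [/=]]]]; rewrite ?in_itv/=.
    move=> xy; pose e := ((r - mdist x y) / 2)%R.
    have e0 : (0 < e)%R by rewrite /e; lra.
    have [n nx] := qP x _ e0.
    have [s]: exists s : rat, ratr s \in `](mdist (q n) x), e[.
      exact: rat_in_itvoo.
    rewrite in_itv/= => /andP[s1 s2].
    exists n => //; exists s => //; split; rewrite /= mem_ballE//.
    rewrite (le_lt_trans (metric_triangle (q n) x y))//.
    by move: s2; rewrite /e; lra.
  rewrite !mem_ballE => nx ny; rewrite (le_lt_trans (metric_triangle x (q n) y))//.
  by rewrite (metric_sym x); lra.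
apply: bigcupT_measurable => n; apply: bigcupT_measurable_rat => s.
by apply: measurableX; exact: measurable_mball.
Qed.

Lemma measurable_fun_mdist2 d (T : measurableType d) (f g : T -> borel X) :
  separable_space X -> measurable_fun setT f -> measurable_fun setT g ->
  measurable_fun setT (fun t => ((mdist (f t : X) (g t)) ^+ 2)%:E : \bar R).
Proof.
move=> sX mf mg; apply/measurable_EFinP; apply: measurable_funX.
rewrite [X in measurable_fun _ X](_ : _ =
  (fun p : (borel X * borel X)%type => mdist (p.1 : X) (p.2 : X)) \o
  (fun t => (f t, g t)))//.
apply: measurableT_comp; first exact: measurable_fun_mdist.
exact: measurable_fun_pair.
Qed.

Lemma enlargementE (Z : set X) r : enlargement Z r = \bigcup_(z in Z) ball z r.
Proof.
apply/seteqP; split => [x|x [z Zz]]; rewrite /enlargement /edist_inf /=.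
  move=> /ereal_inf_lt[_ [z Zz <-]]; rewrite edistE lte_fin metric_sym => xz.
  by exists z => //; rewrite mem_ballE.
rewrite mem_ballE => zx; apply: (@le_lt_trans _ _ (edist (x, z))).
  by apply: ereal_inf_lbound; exists z.
by rewrite edistE lte_fin metric_sym.
Qed.

Lemma open_enlargement (Z : set X) r : open (enlargement Z r).
Proof. by rewrite enlargementE; apply: bigcup_open => z _; exact: open_mball. Qed.

Lemma measurable_enlargement (Z : set X) r :
  measurable (enlargement Z r : set (borel X)).
Proof. by apply: open_borel; exact: open_enlargement. Qed.

Lemma sub_enlargement (Z : set X) r : (0 < r)%R -> Z `<=` enlargement Z r.
Proof. by move=> r0 z Zz; rewrite enlargementE; exists z => //; exact: ballxx. Qed.

Lemma enlargementS (Y Z : set X) r :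
  Y `<=` Z -> enlargement Y r `<=` enlargement Z r.
Proof. by move=> YZ; rewrite !enlargementE; exact: bigcup_subset. Qed.

Lemma enlargement_mball x r e : enlargement (ball x r) e `<=` ball x (r + e)%R.
Proof.
rewrite enlargementE => y [z]; rewrite !mem_ballE => xz zy.
by rewrite (le_lt_trans (metric_triangle x z y))// ltrD.
Qed.

End metric_measurability.

(** * Approximate gluing of couplings *)

Section approximate_gluing.
Context {R : realType} {d1 d2 d3 : measure_display} {T1 : measurableType d1}
  {T2 : measurableType d2} {Y : measurableType d3}.
Variables (P : probability T1 R) (Q : probability T2 R).
Variables (f : T1 -> Y) (g : T2 -> Y) (E : (set Y)^nat).
Hypothesis mf : measurable_fun setT f.
Hypothesis mg : measurable_fun setT g.
Hypothesis fPgQ : forall A, measurable A -> pushforward P f A = pushforward Q g A.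
Hypothesis mE : forall i, measurable (E i).
Hypothesis tE : trivIset setT E.
Hypothesis UE : \bigcup_i E i = setT.

Let mfE i : measurable (f @^-1` E i).
Proof. by rewrite -[X in measurable X]setTI; exact: mf. Qed.

Let mgE i : measurable (g @^-1` E i).
Proof. by rewrite -[X in measurable X]setTI; exact: mg. Qed.

Let QEoo i : Q (g @^-1` E i) < +oo.
Proof. by rewrite (le_lt_trans (probability_le1 _ _))// ltry. Qed.

Let PE_ge0 i : (0 <= (fine (P (f @^-1` E i)))^-1)%R.
Proof. by rewrite invr_ge0 fine_ge0. Qed.

(* The product of P and Q restricted to the event that f and g both fall in
   [E i], normalized by the mass of that event; when the mass is 0 the
   convention 0^-1 = 0 makes the slice vanish, as it should. *)
Let slice i : {measure set (T1 * T2)%type -> \bar R} :=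
  mscale (NngNum (PE_ge0 i)) (mrestr P (mfE i) \x mfrestr (mgE i) (QEoo i)).

Let sliceE i A B : measurable A -> measurable B ->
  slice i (A `*` B) = (fine (P (f @^-1` E i)))^-1%:E *
    (P (A `&` f @^-1` E i) * Q (B `&` g @^-1` E i)).
Proof.
move=> mA mB; rewrite /slice/= /mscale/=.
by rewrite (product_measure1E (mrestr P (mfE i)) (mfrestr (mgE i) (QEoo i))).
Qed.

Let sum_slices (d : measure_display) (T : measurableType d) (S : probability T R)
    (h : T -> Y) (A : set T) : measurable_fun setT h -> measurable A ->
  \sum_(i <oo) S (A `&` h @^-1` E i) = S A.
Proof.
move=> mh mA; rewrite -[in RHS](setIT A) -(preimage_setT h) -UE.
rewrite preimage_bigcup setI_bigcupr measure_bigcup//.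
- by apply: eq_eseriesl => i; rewrite in_setT.
- by move=> i _; apply: measurableI => //; rewrite -[X in measurable X]setTI; exact: mh.
- apply/trivIsetP => i j _ _ ij; apply/seteqP; split => // x [[_ hi] [_ hj]].
  move/trivIsetP : tE => /(_ i j Logic.I Logic.I ij) Eij.
  by have : (E i `&` E j) (h x) by []; rewrite Eij.
Qed.

Let cancel_mass (i : nat) (x : \bar R) : 0 <= x -> x <= P (f @^-1` E i) ->
  (fine (P (f @^-1` E i)))^-1%:E * (x * P (f @^-1` E i)) = x.
Proof.
move=> x0; have : P (f @^-1` E i) \is a fin_num by rewrite fin_num_measure.
move=> /fineK <-; move: (fine (P _)) => p xp /=.
have /fineK : x \is a fin_num by rewrite ge0_fin_numE// (le_lt_trans xp)// ltry.
move: (fine x) => r xr; move: x0 xp; rewrite -{x}xr !lee_fin -!EFinM => x0 xp.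
have [p0|p0] := eqVneq p 0%R; last by rewrite mulrCA mulVf// mulr1.
have -> : r = 0%R by apply/eqP; rewrite eq_le x0 -p0 xp.
by rewrite mul0r mulr0.
Qed.

(** The law that makes P and Q conditionally independent given the piece of the
    partition E that contains the common value of f and g: the sum of the
    normalized products over the pieces. *)
Definition gluing : set (T1 * T2)%type -> \bar R := mseries slice 0.

HB.instance Definition _ := Measure.on gluing.

Lemma gluing_fst A : measurable A -> gluing (A `*` setT) = P A.
Proof.
move=> mA; rewrite /gluing /mseries -(sum_slices P mf mA).
apply: eq_eseriesr => i _; rewrite sliceE// setTI.
have -> : Q (g @^-1` E i) = P (f @^-1` E i) by apply: esym; exact: fPgQ.
by rewrite cancel_mass// measureIr.
Qed.

Lemma gluing_snd B : measurable B -> gluing (setT `*` B) = Q B.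
Proof.
move=> mB; rewrite /gluing /mseries -(sum_slices Q mg mB).
apply: eq_eseriesr => i _; rewrite sliceE// setTI.
rewrite (muleC (P _)) cancel_mass//.
have -> : P (f @^-1` E i) = Q (g @^-1` E i) by exact: fPgQ.
by rewrite measureIr.
Qed.

Let gluing_setT : gluing setT = 1.
Proof. by rewrite -setXTT gluing_fst// probability_setT. Qed.

(** [gluing] as a probability measure. *)
Definition gluing_probability : probability (T1 * T2)%type R :=
  HB.pack gluing (Measure_isProbability.Build _ _ _ gluing gluing_setT).

(** Almost surely, f and g fall in the same piece. *)
Lemma gluing_compl :
  gluing (~` \bigcup_i (f @^-1` E i `*` g @^-1` E i)) = 0.
Proof.
have mU : measurable (\bigcup_i (f @^-1` E i `*` g @^-1` E i)).
  by apply: bigcupT_measurable => i; exact: measurableX.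
rewrite /gluing /mseries eseries0// => i _ _.
apply/eqP; rewrite -measure_le0.
have mD : measurable (~` (f @^-1` E i `*` g @^-1` E i)).
  by apply: measurableC; exact: measurableX.
apply: (@le_trans _ _ (slice i (~` (f @^-1` E i `*` g @^-1` E i)))).
  apply: le_measure; rewrite ?inE//; first exact: measurableC.
  by apply: subsetC => x fgx; exists i.
rewrite [X in slice i X](_ : _ = (~` (f @^-1` E i) `*` setT) `|`
    (setT `*` ~` (g @^-1` E i))); last first.
  apply/seteqP; split => [[x y]/= /not_andP[]|[x y] [[nx _] [x1 x2]|[_ ny] [x1 x2]]]//.
  - by left.
  - by right.
have mC1 := measurableC (mfE i); have mC2 := measurableC (mgE i).
have mC3 := measurableX mC1 (@measurableT _ T2).
have mC4 := measurableX (@measurableT _ T1) mC2.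
apply: (@le_trans _ _ (slice i (~` (f @^-1` E i) `*` setT) +
    slice i (setT `*` ~` (g @^-1` E i)))); first exact: measureU2.
have := sliceE i mC1 (@measurableT _ T2).
rewrite setICl measure0 mul0e mule0 => ->; rewrite add0e.
have := sliceE i (@measurableT _ T1) mC2.
by rewrite setICl measure0 !mule0 => ->.
Qed.

End approximate_gluing.

Section metric_gluing.
Context {R : realType} (X : completeMetricType R).

(** Two probability measures inducing the same law on X through f and g admit
    a joint law under which f and g are almost surely at distance less than e. *)
Lemma approximate_gluing d1 d2 (T1 : measurableType d1) (T2 : measurableType d2)
    (P : probability T1 R) (Q : probability T2 R)
    (f : T1 -> borel X) (g : T2 -> borel X) (e : R) :
  separable_space X -> measurable_fun setT f -> measurable_fun setT g ->
  (forall A, measurable A -> pushforward P f A = pushforward Q g A) ->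
  (0 < e)%R ->
  exists G : probability (T1 * T2)%type R,
    [/\ forall A, measurable A -> pushforward G fst A = P A,
        forall B, measurable B -> pushforward G snd B = Q B &
        {ae G, forall p, (mdist (f p.1 : X) (g p.2) < e)%R}].
Proof.
move=> /dense_sequence[q qP] mf mg fPgQ e0.
pose F i : set (borel X) := ball (q i : X) (e / 2)%R.
have mF i : measurable (F i) by exact: measurable_mball.
have mE := seqDU_measurable mF.
have UE : \bigcup_i seqDU F i = setT.
  rewrite -seqDU_bigcup_eq -subTset => x _.
  have [|n nx] := qP x (e / 2)%R; first by rewrite divr_gt0.
  by exists n => //; rewrite /F mem_ballE.
have mfE i : measurable (f @^-1` seqDU F i).
  by rewrite -[X in measurable X]setTI; exact: mf.
have mgE i : measurable (g @^-1` seqDU F i).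
  by rewrite -[X in measurable X]setTI; exact: mg.
pose G : probability (T1 * T2)%type R :=
  gluing_probability mf mg fPgQ mE (trivIset_seqDU F) UE.
exists G; split.
- move=> A mA; rewrite /pushforward.
  have -> : fst @^-1` A = A `*` setT :> set (T1 * T2)%type.
    by apply/seteqP; split => [[x y]//|[x y] []].
  exact: (gluing_fst mf mg fPgQ mE (trivIset_seqDU F) UE).
- move=> B mB; rewrite /pushforward.
  have -> : snd @^-1` B = setT `*` B :> set (T1 * T2)%type.
    by apply/seteqP; split => [[x y]//|[x y] []].
  exact: (gluing_snd mf mg fPgQ mE (trivIset_seqDU F) UE).
- exists (~` \bigcup_i (f @^-1` seqDU F i `*` g @^-1` seqDU F i)); split.
  + apply: measurableC; apply: bigcupT_measurable => i.
    exact: measurableX (mfE i) (mgE i).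
  + exact: gluing_compl.
  + apply: subsetC => -[x y] [i _ [/= fx gy]].
    move: (subset_seqDU fx) (subset_seqDU gy).
    rewrite /F !mem_ballE => qf qg.
    rewrite (le_lt_trans (metric_triangle _ (q i) _))// metric_sym.
    by rewrite [ltRHS]splitr ltrD.
Qed.

End metric_gluing.

(** * Marginals and the Wasserstein distance *)

Section marginals.
Context {R : realType} {d1 d2 : measure_display} {T1 : measurableType d1}
  {T2 : measurableType d2}.

Lemma ge0_integral_marginal (G : {measure set T1 -> \bar R})
    (Q : {measure set T2 -> \bar R}) (f : T1 -> T2) (h : T2 -> \bar R) :
  measurable_fun setT f ->
  (forall A, measurable A -> pushforward G f A = Q A) ->
  measurable_fun setT h -> (forall y, 0 <= h y) ->
  \int[Q]_y h y = \int[G]_x h (f x).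
Proof.
move=> mf GQ mh h0.
rewrite -[RHS](@ge0_integral_pushforward _ _ _ _ R f mf G setT h)//.
by apply: eq_measure_integral => A mA _; apply: esym; exact: GQ.
Qed.

Lemma pushforward_probability (P : probability T1 R) (f : T1 -> T2) :
  measurable_fun setT f ->
  exists Q : probability T2 R, forall A, pushforward P f A = Q A.
Proof.
move=> mf.
pose g : {mfun T1 >-> T2} := HB.pack f (isMeasurableFun.Build _ _ _ _ _ mf).
by exists (distribution P g).
Qed.

Lemma ae_marginal (G : {measure set T1 -> \bar R})
    (Q : {measure set T2 -> \bar R}) (f : T1 -> T2) (A : set T2) :
  measurable_fun setT f ->
  (forall A, measurable A -> pushforward G f A = Q A) ->
  measurable A -> Q (~` A) = 0 -> {ae G, forall x, A (f x)}.
Proof.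
move=> mf GQ mA QA; exists (f @^-1` (~` A)); split => //.
- by rewrite -[X in measurable X]setTI; apply: mf => //; exact: measurableC.
- by have := GQ _ (measurableC mA); rewrite QA.
Qed.

End marginals.

Section wasserstein.
Context {R : realType} (X : completeMetricType R).
Implicit Types (mu nu : probability (borel X) R).

Lemma W2_le mu nu g : is_coupling mu nu g ->
  (W2 mu nu) ^+ 2 <= \int[g]_p ((mdist (p.1 : X) p.2) ^+ 2)%:E.
Proof.
move=> cg; rewrite /W2 sqr_sqrte.
  by apply: ereal_inf_lbound; exists g.
by apply: le_ereal_inf_tmp => _ [h _ <-]; apply: integral_ge0 => p _; rewrite lee_fin sqr_ge0.
Qed.

Lemma W2_adherent mu nu (w e : R) : W2 mu nu = w%:E -> (0 < e)%R ->
  exists2 g, is_coupling mu nu g &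
    \int[g]_p ((mdist (p.1 : X) p.2) ^+ 2)%:E <= (w ^+ 2 + e)%:E.
Proof.
move=> Ww e0; have : (W2 mu nu) ^+ 2 < (w ^+ 2 + e)%:E.
  by rewrite Ww -EFin_expe lte_fin ltrDl.
rewrite {1}/W2 sqr_sqrte; last first.
  by apply: le_ereal_inf_tmp => _ [h _ <-]; apply: integral_ge0 => p _; rewrite lee_fin sqr_ge0.
by move=> /ereal_inf_lt[_ [g cg <-] /ltW]; exists g.
Qed.

(** Expand a = t c + u and b = (1 - t) c + v: the cross term 2 c (u + v) is at
    least - 2 D e since c <= a + b + e, and u^2 / t >= s^2. *)
Lemma interpolation_ineq (a b c D t e s : R) : (0 <= c)%R ->
  (c <= a + b + e)%R -> (c <= D)%R -> (0 < e)%R -> (0 < t)%R -> (t < 1)%R ->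
  (s = 0 \/ 0 <= s /\ t * c + s <= a)%R ->
  (c ^+ 2 + s ^+ 2 <= t^-1 * a ^+ 2 + (1 - t)^-1 * b ^+ 2 + 2 * D * e)%R.
Proof.
move=> c0 cab cD e0 t0 t1 sa.
pose u := (a - t * c)%R; pose v := (b - (1 - t) * c)%R.
have t1' : (0 < 1 - t)%R by rewrite subr_gt0.
have -> : (t^-1 * a ^+ 2 = t * c ^+ 2 + 2 * c * u + t^-1 * u ^+ 2)%R.
  by rewrite /u; field; rewrite gt_eqF.
have -> : ((1 - t)^-1 * b ^+ 2 =
    (1 - t) * c ^+ 2 + 2 * c * v + (1 - t)^-1 * v ^+ 2)%R.
  by rewrite /v; field; rewrite gt_eqF.
have su : (s ^+ 2 <= t^-1 * u ^+ 2)%R.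
  case: sa => [->|[s0 sa]]; first by rewrite expr0n/= mulr_ge0 ?sqr_ge0 ?invr_ge0 ?ltW.
  have su : (s <= u)%R by rewrite /u; lra.
  apply: (@le_trans _ _ (u ^+ 2)%R); first by rewrite lerXn2r ?nnegrE// (le_trans s0).
  by rewrite ler_peMl ?sqr_ge0// invf_ge1// ltW.
have v0 : (0 <= (1 - t)^-1 * v ^+ 2)%R by rewrite mulr_ge0 ?sqr_ge0 ?invr_ge0 ?ltW.
have uv : (- (D * e) <= c * (u + v))%R.
  apply: (@le_trans _ _ (- (c * e))%R).
    by rewrite lerN2 ler_wpM2r// ltW.
  by rewrite -mulrN ler_wpM2l// /u /v; lra.
move: (t^-1 * _)%R ((1 - t)^-1 * _)%R su v0 => U V; nra.
Qed.

End wasserstein.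

(** * Concentration of Wasserstein interpolants *)

Section concentration.
Context {R : realType} (X : completeMetricType R).
Hypothesis sX : separable_space X.
Implicit Types (mu nu la : probability (borel X) R) (A B : set (borel X)).

Let sqd (p : (borel X * borel X)%type) : \bar R :=
  ((mdist (p.1 : X) (p.2 : X)) ^+ 2)%:E.

Let measurable_sqd : measurable_fun setT sqd.
Proof. by apply: measurable_fun_mdist2. Qed.

Let sqd_ge0 p : 0 <= sqd p.
Proof. by rewrite lee_fin sqr_ge0. Qed.

(** Chebyshev-type bound obtained from d-optimal couplings glued up to d; the
    factor of d on the right is the total defect in [interpolation_ineq]. *)
Lemma interpolant_tail mu nu la A B (w t D e s d : R) :
  measurable A -> measurable B -> mu (~` A) = 0 -> la (~` B) = 0 ->
  (0 < t)%R -> (t < 1)%R -> (0 <= D)%R ->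
  W2 mu nu = (t * w)%:E -> W2 nu la = ((1 - t) * w)%:E -> W2 mu la = w%:E ->
  (forall x z, A x -> B z -> mdist (x : X) (z : X) <= D)%R ->
  (0 <= s)%R -> (t * D + s <= e)%R -> (0 < d)%R ->
  (s ^+ 2)%:E * nu (~` enlargement A e) <=
    (d * (t^-1 + (1 - t)^-1 + 2 * D))%:E.
Proof.
move=> mA mB muA laB t0 t1 D0 Wt W1t W AB s0 tDe d0.
have t1' : (0 < 1 - t)%R by rewrite subr_gt0.
pose Z : set (borel X) := ~` enlargement A e; rewrite -/Z.
have mZ : measurable Z.
  by apply: measurableC; exact: measurable_enlargement.
have [P cP IP] := W2_adherent Wt d0.
have [Q cQ IQ] := W2_adherent W1t d0.
have [G [GP GQ Gd]] : exists G : probability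
    ((borel X * borel X) * (borel X * borel X))%type R,
    [/\ forall E, measurable E -> pushforward G fst E = P E,
        forall E, measurable E -> pushforward G snd E = Q E &
        {ae G, forall p, (mdist (p.1.2 : X) p.2.1 < d)%R}].
  apply: (approximate_gluing (f := snd) (g := fst)) => //.
  by move=> E mE; rewrite (cP _ mE).2 (cQ _ mE).1.
pose xz (p : ((borel X * borel X) * (borel X * borel X))%type) := (p.1.1, p.2.2).
have mxz : measurable_fun setT xz.
  by apply: measurable_fun_pair; apply: measurableT_comp.
have mfst1 : measurable_fun setT
    (fun p : ((borel X * borel X) * (borel X * borel X))%type => p.1.1).
  exact: measurableT_comp.
have msnd1 : measurable_fun setT
    (fun p : ((borel X * borel X) * (borel X * borel X))%type => p.1.2).
  exact: measurableT_comp.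
have msnd2 : measurable_fun setT
    (fun p : ((borel X * borel X) * (borel X * borel X))%type => p.2.2).
  exact: measurableT_comp.
have [S GS] := pushforward_probability G mxz.
have Gmu E : measurable E ->
    pushforward G (fun p => p.1.1) E = mu E.
  move=> mE; rewrite -(cP _ mE).1 /pushforward -GP//.
  by rewrite -[X in measurable X]setTI; exact: measurable_fst.
have Gnu E : measurable E ->
    pushforward G (fun p => p.1.2) E = nu E.
  move=> mE; rewrite -(cP _ mE).2 /pushforward -GP//.
  by rewrite -[X in measurable X]setTI; exact: measurable_snd.
have Gla E : measurable E ->
    pushforward G (fun p => p.2.2) E = la E.
  move=> mE; rewrite -(cQ _ mE).2 /pushforward -GQ//.
  by rewrite -[X in measurable X]setTI; exact: measurable_snd.
have cS : is_coupling mu la S.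
  move=> E mE; split.
    by rewrite -(Gmu _ mE); apply: esym; exact: GS.
  by rewrite -(Gla _ mE); apply: esym; exact: GS.
(* under G the extreme points x and z form a coupling of mu and la, whose cost
   is bounded below by the squared distance *)
have IS : (w ^+ 2)%:E <= \int[G]_p sqd (xz p).
  have := W2_le cS; rewrite W -EFin_expe.
  by rewrite (ge0_integral_marginal mxz (fun E _ => GS E) measurable_sqd sqd_ge0).
have IG1 : \int[G]_p sqd p.1 <= ((t * w) ^+ 2 + d)%:E.
  by rewrite -(ge0_integral_marginal measurable_fst GP measurable_sqd sqd_ge0).
have IG2 : \int[G]_p sqd p.2 <= (((1 - t) * w) ^+ 2 + d)%:E.
  by rewrite -(ge0_integral_marginal measurable_snd GQ measurable_sqd sqd_ge0).
have mSZ : measurable_fun setT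
    (fun p : ((borel X * borel X) * (borel X * borel X))%type =>
      (\1_Z p.1.2 : R)%:E).
  apply/measurable_EFinP.
  exact: (measurableT_comp (measurable_indic mZ) msnd1).
have m1 : measurable_fun setT
    (fun p : ((borel X * borel X) * (borel X * borel X))%type => sqd p.1).
  exact: measurableT_comp.
have m2 : measurable_fun setT
    (fun p : ((borel X * borel X) * (borel X * borel X))%type => sqd p.2).
  exact: measurableT_comp.
have mxz2 : measurable_fun setT (fun p => sqd (xz p)).
  exact: measurableT_comp.
have main : \int[G]_p (sqd (xz p) + (s ^+ 2)%:E * (\1_Z p.1.2)%:E) <=
  \int[G]_p ((t^-1)%:E * sqd p.1 + ((1 - t)^-1)%:E * sqd p.2 + (2 * D * d)%:E).
  apply: ae_ge0_le_integral => //.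
  - by move=> p _; rewrite adde_ge0// mule_ge0 ?lee_fin ?sqr_ge0.
  - by apply: emeasurable_funD => //; exact: measurable_funeM.
  - move=> p _; apply: adde_ge0; last by rewrite lee_fin !mulr_ge0// ltW.
    by rewrite adde_ge0// mule_ge0// lee_fin invr_ge0 ltW.
  - apply: emeasurable_funD => //; apply: emeasurable_funD => //;
      exact: measurable_funeM.
  have aA := ae_marginal mfst1 Gmu mA muA.
  have aB := ae_marginal msnd2 Gla mB laB.
  near=> p => _.
  have pA : A p.1.1 by near: p.
  have pB : B p.2.2 by near: p.
  have pd : (mdist (p.1.2 : X) p.2.1 < d)%R by near: p.
  rewrite /sqd -!EFinM -!EFinD lee_fin.
  have cD := AB _ _ pA pB.
  have -> : (s ^+ 2 * \1_Z p.1.2 = (s * \1_Z p.1.2) ^+ 2)%R.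
    by rewrite indicE; case: (_ \in _); rewrite ?mulr1 ?mulr0 ?expr0n.
  apply: interpolation_ineq => //.
  - exact: mdist_ge0.
  - have := metric_triangle (p.1.1 : X) p.1.2 p.2.2.
    have := metric_triangle (p.1.2 : X) p.2.1 p.2.2.
    move: pd; rewrite /=; lra.
  - rewrite indicE; have [pZ|_] := boolP (_ \in _); last by left; rewrite mulr0.
    right; rewrite mulr1; split => //.
    move: pZ; rewrite inE /Z /= enlargementE => pZ.
    have ea : (e <= mdist (p.1.1 : X) p.1.2)%R.
      by rewrite leNgt; apply/negP => ea; apply: pZ; exists p.1.1; rewrite ?mem_ballE.
    apply: le_trans ea; apply: le_trans tDe; rewrite lerD2r.
    by rewrite ler_wpM2l// ltW.
move: main.
rewrite ge0_integralD//; last 2 first.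
  - by move=> p _; rewrite mule_ge0 ?lee_fin ?sqr_ge0.
  - exact: measurable_funeM.
rewrite ge0_integralD//; last 3 first.
  - by move=> p _; rewrite adde_ge0// mule_ge0// lee_fin invr_ge0 ltW.
  - by apply: emeasurable_funD => //; exact: measurable_funeM.
  - by move=> p _; rewrite lee_fin !mulr_ge0// ltW.
rewrite ge0_integralD//; last 4 first.
  - by move=> p _; rewrite mule_ge0// lee_fin invr_ge0 ltW.
  - exact: measurable_funeM.
  - by move=> p _; rewrite mule_ge0// lee_fin invr_ge0 ltW.
  - exact: measurable_funeM.
rewrite !ge0_integralZl//; last 3 first.
  - by rewrite lee_fin invr_ge0 ltW.
  - by rewrite lee_fin invr_ge0 ltW.
  - by rewrite lee_fin sqr_ge0.
have -> : \int[G]_p (2 * D * d)%:E = (2 * D * d)%:E.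
  rewrite (integral_cst G measurableT (2 * D * d)%:E).
  by rewrite -[RHS]mule1; congr (_ * _); exact: probability_setT.
rewrite -(ge0_integral_marginal msnd1 Gnu (h := fun y => (\1_Z y)%:E))//; last first.
  by apply/measurable_EFinP; exact: measurable_indic.
rewrite integral_indic// setIT => main.
have : (w ^+ 2)%:E + (s ^+ 2)%:E * nu Z <=
    (t^-1)%:E * ((t * w) ^+ 2 + d)%:E +
    ((1 - t)^-1)%:E * (((1 - t) * w) ^+ 2 + d)%:E + (2 * D * d)%:E.
  apply: le_trans (le_trans main _); first exact: leeD.
  apply: leeD => //; apply: leeD; apply: lee_wpmul2l => //.
  - by rewrite lee_fin invr_ge0 ltW.
  - by rewrite lee_fin invr_ge0 ltW.
have : nu Z \is a fin_num by rewrite fin_num_measure.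
move=> /fineK <-; rewrite -!EFinM -!EFinD !lee_fin.
have -> : (t^-1 * ((t * w) ^+ 2 + d) = t * w ^+ 2 + t^-1 * d)%R.
  by field; rewrite gt_eqF.
have -> : ((1 - t)^-1 * (((1 - t) * w) ^+ 2 + d) =
    (1 - t) * w ^+ 2 + (1 - t)^-1 * d)%R.
  by field; rewrite gt_eqF.
by rewrite !mulrDr; lra.
Unshelve. all: by end_near. Qed.

(** A measure at W2-distances t w and (1 - t) w from mu and la, themselves at
    distance w, is concentrated on the e-enlargement of A as soon as t times the
    largest distance between A and B is less than e. *)
Lemma interpolant_concentration mu nu la A B (w t D e : R) :
  measurable A -> measurable B -> mu (~` A) = 0 -> la (~` B) = 0 ->
  (0 < t)%R -> (t < 1)%R -> (0 <= D)%R ->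
  W2 mu nu = (t * w)%:E -> W2 nu la = ((1 - t) * w)%:E -> W2 mu la = w%:E ->
  (forall x z, A x -> B z -> mdist (x : X) (z : X) <= D)%R ->
  (t * D < e)%R ->
  nu (~` enlargement A e) = 0.
Proof.
move=> mA mB muA laB t0 t1 D0 Wt W1t W AB tDe.
pose Z : set (borel X) := ~` enlargement A e; rewrite -/Z.
have mZ : measurable Z.
  by apply: measurableC; exact: measurable_enlargement.
have s0 : (0 < e - t * D)%R by rewrite subr_gt0.
pose K := (t^-1 + (1 - t)^-1 + 2 * D)%R.
have K0 : (0 < K)%R.
  by rewrite /K ltr_wpDr ?mulr_ge0// addr_gt0// invr_gt0// subr_gt0.
apply/eqP; rewrite -measure_le0; apply/lee_addgt0Pr => r r0; rewrite add0e.
(* the value of d for which the bound of [interpolant_tail] becomes r *)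
pose d := (r * (e - t * D) ^+ 2 / K)%R.
have d0 : (0 < d)%R by rewrite divr_gt0// mulr_gt0// exprn_gt0.
have := @interpolant_tail mu nu la A B w t D e (e - t * D)%R d mA mB muA laB
  t0 t1 D0 Wt W1t W AB (ltW s0).
rewrite addrCA subrr addr0 lexx => /(_ isT d0).
rewrite -/K /d divfK ?gt_eqF// -/Z.
have /fineK <- : nu Z \is a fin_num by rewrite fin_num_measure.
rewrite -EFinM lee_fin (mulrC _ (fine _)) ler_pM2r ?exprn_gt0//.
by rewrite -lee_fin fineK// fin_num_measure.
Qed.

End concentration.

(** * The entropy of a concentrated measure *)

Section entropy.
Context {R : realType} (X : completeMetricType R).
Implicit Types (m : {measure set (borel X) -> \bar R}).
Implicit Types (mu : probability (borel X) R) (rho : borel X -> R).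

(** The convex function s ln s lies above its tangent at c. *)
Lemma xlnx_tangent (s c : R) : (0 <= s)%R -> (0 < c)%R ->
  ((1 + ln c) * s - c <= s * ln s)%R.
Proof.
move=> s0 c0; have [->|sn0] := eqVneq s 0%R; first by rewrite mulr0 mul0r; lra.
have sp : (0 < s)%R by rewrite lt_neqAle eq_sym sn0.
have cs : (0 < c / s)%R by rewrite divr_gt0.
have : (ln (c / s) <= c / s - 1)%R.
  have {1}-> : (c / s = 1 + (c / s - 1))%R by lra.
  by apply: le_ln1Dx; lra.
rewrite ln_div ?posrE// -(ler_pM2l sp) !mulrBr.
by rewrite (mulrC s (c / s)%R) divfK// mulr1; lra.
Qed.

Lemma measurable_xlnx rho : measurable_fun setT rho ->
  measurable_fun setT (fun x => (rho x * ln (rho x))%R%:E : \bar R).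
Proof.
move=> mrho; apply/measurable_EFinP; apply: measurable_funM => //.
by apply: measurableT_comp => //; exact: measurable_ln.
Qed.

Lemma is_density_integral m mu rho : is_density m mu rho ->
  \int[m]_x (rho x)%:E = 1.
Proof.
by move=> [_ _ /(_ setT measurableT)] <-; exact: probability_setT.
Qed.

Lemma is_density_null m mu rho (A : set (borel X)) : is_density m mu rho ->
  measurable A -> mu A = 0 -> {ae m, forall x, A x -> rho x = 0%R}.
Proof.
move=> [mrho rho0 dmu] mA muA.
have : ae_eq m A (EFin \o rho) (cst 0).
  apply/ae_eq_integral_abs => //.
    by apply/measurable_EFinP; exact: measurable_funTS.
  rewrite -muA dmu//; apply: eq_integral => x _ /=.
  by rewrite ger0_norm.
by apply: filterS => x /= + Ax => /(_ Ax) [].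
Qed.

(** Jensen's inequality for s ln s, in the form of integrating the tangent at
    1 / c over Z. Every term is first moved to the side where it is
    nonnegative, so the positive part of the integrand may have an infinite
    integral. *)
Lemma jensen_entropy m mu rho (Z : set (borel X)) (c : R) :
  is_density m mu rho -> measurable Z -> mu (~` Z) = 0 ->
  (0 < c)%R -> m Z = c%:E -> (- ln c)%:E <= int_rho_ln_rho m rho.
Proof.
move=> dmu mZ muZ c0 mZc; have [mrho rho0 _] := dmu.
rewrite /int_rho_ln_rho.
set f : borel X -> \bar R := fun x => (rho x * ln (rho x))%R%:E.
have mf : measurable_fun setT f by exact: measurable_xlnx.
pose K : R := (1 - ln c)%R.
pose Kp := Num.max K 0%R; pose Kn := Num.max (- K)%R 0%R.
have Kp0 : (0 <= Kp)%R by rewrite le_max lexx orbT.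
have Kn0 : (0 <= Kn)%R by rewrite le_max lexx orbT.
have KE : (K = Kp - Kn)%R.
  have [K0|/ltW K0] := lerP 0%R K.
    by rewrite /Kp /Kn max_l// max_r ?oppr_le0// subr0.
  by rewrite /Kp /Kn max_r// max_l ?oppr_ge0// sub0r opprK.
have mrhoE : measurable_fun setT (fun x => (rho x)%:E : \bar R).
  exact/measurable_EFinP.
have mZ1 : measurable_fun setT (fun x => (\1_Z x : R)%:E : \bar R).
  by apply/measurable_EFinP; exact: measurable_indic.
have rhoE0 x : 0 <= (rho x)%:E by rewrite lee_fin.
have mfp := measurable_funepos mf.
have mfn := measurable_funeneg mf.
have cV0 : (0 <= c^-1)%R by rewrite invr_ge0 ltW.
have main : \int[m]_x (f^\- x + Kp%:E * (rho x)%:E) <=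
   \int[m]_x (f^\+ x + Kn%:E * (rho x)%:E + (c^-1)%:E * (\1_Z x)%:E).
  apply: ae_ge0_le_integral => //.
  - by move=> x _; rewrite adde_ge0// ?funeneg_ge0// mule_ge0.
  - by apply: emeasurable_funD => //; exact: measurable_funeM.
  - by move=> x _; apply: adde_ge0; [apply: adde_ge0|]; rewrite ?mule_ge0.
  - apply: emeasurable_funD; last exact: measurable_funeM.
    by apply: emeasurable_funD => //; exact: measurable_funeM.
  have := is_density_null dmu (measurableC mZ) muZ.
  apply: filterS => x rZ _; rewrite funeposE funenegE /f -EFinN.
  rewrite -!EFin_max -!EFinM -!EFinD lee_fin indicE.
  have [Zx|Zx] := boolP (x \in Z); last first.
    rewrite rZ; last by move: Zx; rewrite notin_setE.
    by rewrite !mul0r !mulr0 oppr0 maxxx !addr0.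
  rewrite mulr1 /=.
  have := @xlnx_tangent (rho x) c^-1 (rho0 x).
  rewrite invr_gt0 lnV ?posrE// => /(_ c0); rewrite -/K KE.
  move: (rho x * ln (rho x))%R => L; rewrite mulrBl => ?.
  by rewrite !maxEle; case: ifPn; case: ifPn; lra.
move: main.
rewrite ge0_integralD//; last 2 first.
  - by move=> x _; rewrite mule_ge0.
  - exact: measurable_funeM.
rewrite ge0_integralD//; last 4 first.
  - by move=> x _; rewrite adde_ge0// ?funepos_ge0// mule_ge0.
  - by apply: emeasurable_funD => //; exact: measurable_funeM.
  - by move=> x _; rewrite mule_ge0// lee_fin.
  - exact: measurable_funeM.
rewrite ge0_integralD//; last 2 first.
  - by move=> x _; rewrite mule_ge0.
  - exact: measurable_funeM.
rewrite !ge0_integralZl// (is_density_integral dmu) !mule1.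
rewrite integral_indic// setIT mZc -EFinM mulVf ?gt_eqF//.
have : 0 <= \int[m]_x f^\+ x by apply: integral_ge0.
have : 0 <= \int[m]_x f^\- x by apply: integral_ge0.
move: (\int[m]_x f^\+ x) (\int[m]_x f^\- x) => [u| |] [v| |]//=.
- move=> _ _; rewrite -!EFinD !lee_fin => uv.
  change ((- ln c)%:E <= (u - v)%:E); rewrite lee_fin.
  by move: KE; rewrite /K; lra.
- by move=> _ _ _; exact: leey.
- by move=> _ _ _; exact: leey.
Qed.

End entropy.

(** * Uniform distributions *)

Section uniform_measure.
Context {R : realType} (X : completeMetricType R).
Variable m : {measure set (borel X) -> \bar R}.
Variables (A : set (borel X)) (c : R).
Hypotheses (mA : measurable A) (c0 : (0 < c)%R) (mAc : m A = c%:E).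
Implicit Types mu : probability (borel X) R.

(** mu is the normalized restriction of m to A, where c = m(A). *)
Definition uniform_on mu : Prop :=
  forall E, measurable E -> mu E = (c^-1)%:E * m (E `&` A).

Lemma uniform_on_exists : exists mu, uniform_on mu.
Proof.
exists (mnormalize (mrestr m mA) (dirac (point : borel X))) => E mE.
rewrite /= /mnormalize /= /mrestr; rewrite setTI mAc eqe gt_eqF//= muleC.
by congr (_ * _).
Qed.

Variable mu : probability (borel X) R.
Hypothesis muA : uniform_on mu.

Lemma uniform_on_setC : mu (~` A) = 0.
Proof.
have := muA (measurableC mA).
by rewrite setICl measure0 mule0.
Qed.

Lemma uniform_on_dominates : mu `<< m.
Proof.
apply/null_content_dominatesP => E mE mE0.
rewrite (muA mE).
have -> : m (E `&` A) = 0 by apply: (subset_measure0 _ _ _ mE0) => //; exact: measurableI.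
by rewrite mule0.
Qed.

Lemma uniform_on_density : is_density m mu (fun x => (c^-1 * \1_A x)%R).
Proof.
split.
- by apply: measurable_funM => //; exact: measurable_indic.
- by move=> x; rewrite mulr_ge0// invr_ge0 ltW.
- move=> E mE; rewrite (muA mE).
  under eq_integral do rewrite EFinM.
  have cV0 : 0 <= (c^-1)%:E by rewrite lee_fin invr_ge0 ltW.
  have mindic : measurable_fun E (fun x => (\1_A x : R)%:E : \bar R).
    by apply/measurable_EFinP; exact: measurable_indic.
  have indic0 x : E x -> 0 <= (\1_A x : R)%:E by rewrite lee_fin.
  by rewrite ge0_integralZl// integral_indic// setIC.
Qed.

Lemma uniform_on_second_moment (x0 : X) (r : R) : separable_space X ->
  A `<=` ball x0 r -> finite_second_moment mu.
Proof.
move=> sX Ar; exists x0.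
have aA : {ae mu, forall x, A x}.
  exists (~` A); split => //; first exact: measurableC.
  exact: uniform_on_setC.
apply: (@le_lt_trans _ _ (\int[mu]_x (r ^+ 2)%:E)).
  apply: ae_ge0_le_integral => //.
  - by move=> x _; rewrite lee_fin sqr_ge0.
  - apply: measurable_fun_mdist2 => //.
  - by move=> x _; rewrite lee_fin sqr_ge0.
  apply: filterS aA => x /Ar; rewrite mem_ballE => xr _; rewrite lee_fin.
  have r0 := le_trans (mdist_ge0 x0 x) (ltW xr).
  by rewrite lerXn2r ?nnegrE ?mdist_ge0// ltW.
rewrite (integral_cst mu measurableT (r ^+ 2)%:E).
rewrite [ltLHS](_ : _ = (r ^+ 2)%:E) ?ltry//.
by rewrite -[RHS]mule1; congr (_ * _); exact: probability_setT.
Qed.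

Lemma uniform_on_Ent : Ent m mu = (- ln c)%:E.
Proof.
rewrite /Ent; case: pselect => [h|[]]; last first.
  by exists (fun x => (c^-1 * \1_A x)%R); exact: uniform_on_density.
move: (sval (cid h)) (svalP (cid h)) => rho drho.
have [mrho rho0 rhoE] := drho.
have [mden den0 denE] := uniform_on_density.
have mindic : measurable_fun setT (fun x => (\1_A x : R)%:E : \bar R).
  by apply/measurable_EFinP; exact: measurable_indic.
(* Ent is computed from an arbitrary density, which agrees almost everywhere
   with the explicit one *)
have rhoA : {ae m, forall x, rho x = (c^-1 * \1_A x)%R}.
  have : ae_eq m setT (fun x => (c^-1 * \1_A x)%:E) (fun x => (rho x)%:E).
    apply: integral_ae_eq => //.
    - apply/integrableP; split; first exact/measurable_EFinP.
      under eq_integral do rewrite gee0_abs ?lee_fin//.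
      by rewrite -denE// (le_lt_trans (probability_le1 _ _)) ?ltry.
    - exact/measurable_EFinP.
    - by move=> E _ mE; rewrite -denE// -rhoE.
  by apply: filterS => x /(_ Logic.I) [].
rewrite /int_rho_ln_rho.
set f : borel X -> \bar R := fun x => (rho x * ln (rho x))%R%:E.
have mf : measurable_fun setT f by exact: measurable_xlnx.
pose v := (c^-1 * ln c^-1)%R.
have fE : {ae m, forall x, f x = (v * \1_A x)%:E}.
  apply: filterS rhoA => x rx; rewrite /f rx indicE.
  by case: (_ \in _); rewrite ?mulr1 ?mulr0 ?mul0r.
have part (w : R) : (0 <= w)%R ->
    \int[m]_x (w%:E * (\1_A x)%:E) = (w * c)%:E.
  by move=> w0; rewrite ge0_integralZl// integral_indic// setIT mAc.
have fp : \int[m]_x f^\+ x = (Num.max v 0 * c)%:E.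
  rewrite -part; last by rewrite le_max lexx orbT.
  apply: ge0_ae_eq_integral => //.
  - exact: measurable_funepos.
  - exact: measurable_funeM.
  - by move=> x _; rewrite mule_ge0 ?lee_fin// le_max lexx orbT.
  apply: filterS fE => x fx _; rewrite funeposE fx -EFin_max -EFinM indicE.
  by case: (_ \in _); rewrite ?mulr1// !mulr0 maxxx.
have fn : \int[m]_x f^\- x = (Num.max (- v) 0 * c)%:E.
  rewrite -part; last by rewrite le_max lexx orbT.
  apply: ge0_ae_eq_integral => //.
  - exact: measurable_funeneg.
  - exact: measurable_funeM.
  - by move=> x _; rewrite mule_ge0 ?lee_fin// le_max lexx orbT.
  apply: filterS fE => x fx _.
  rewrite funenegE fx -EFinN -EFin_max -EFinM indicE.
  by case: (_ \in _); rewrite ?mulr1// !mulr0 oppr0 maxxx.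
rewrite fp fn; change ((Num.max v 0 * c - Num.max (- v) 0 * c)%:E = (- ln c)%:E).
congr EFin; rewrite -mulrBl.
have -> : (Num.max v 0 - Num.max (- v) 0 = v)%R.
  have /orP[v0|v0] := le_total 0%R v.
    by rewrite max_l// max_r ?oppr_le0// subr0.
  by rewrite max_r// max_l ?oppr_ge0// sub0r opprK.
by rewrite /v mulrAC mulVf ?gt_eqF// mul1r lnV// posrE.
Qed.

End uniform_measure.

(** * The Brunn-Minkowski inequality *)

Section brunn_minkowski.
Context {R : realType} (X : completeMetricType R).
Hypothesis sX : separable_space X.
Implicit Types (mu nu : probability (borel X) R) (A B : set (borel X)).

Lemma product_coupling mu nu :
  exists g : probability (borel X * borel X)%type R, is_coupling mu nu g.
Proof.
pose g : probability (borel X * borel X)%type R := (mu \x nu).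
exists g => E mE; rewrite /pushforward; split.
- have -> : fst @^-1` E = E `*` setT :> set (borel X * borel X)%type.
    by apply/seteqP; split => [[x y]//|[x y] []].
  rewrite /g /= product_measure1E//.
  by rewrite -[RHS]mule1; congr (_ * _); exact: probability_setT.
- have -> : snd @^-1` E = setT `*` E :> set (borel X * borel X)%type.
    by apply/seteqP; split => [[x y]//|[x y] []].
  rewrite /g /= product_measure1E//.
  by rewrite -[RHS]mul1e; congr (_ * _); exact: probability_setT.
Qed.

Lemma W2_finite mu nu A B (D : R) : measurable A -> measurable B ->
  mu (~` A) = 0 -> nu (~` B) = 0 ->
  (forall x z, A x -> B z -> mdist (x : X) (z : X) <= D)%R ->
  exists w : R, W2 mu nu = w%:E.
Proof.
move=> mA mB muA nuB AB.
have [g cg] := product_coupling mu nu.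
have gmu E : measurable E -> pushforward g fst E = mu E by move=> /cg[].
have gnu E : measurable E -> pushforward g snd E = nu E by move=> /cg[].
have aA := ae_marginal measurable_fst gmu mA muA.
have aB := ae_marginal measurable_snd gnu mB nuB.
have : (W2 mu nu) ^+ 2 <= (D ^+ 2)%:E.
  apply: (le_trans (W2_le cg)).
  apply: (@le_trans _ _ (\int[g]_x (D ^+ 2)%:E)).
    apply: ae_ge0_le_integral => //.
    - by move=> p _; rewrite lee_fin sqr_ge0.
    - exact: measurable_fun_mdist2.
    - by move=> p _; rewrite lee_fin sqr_ge0.
    apply: filterS2 aA aB => p pA pB _; rewrite lee_fin.
    have pD := AB _ _ pA pB.
    by rewrite lerXn2r ?nnegrE ?mdist_ge0// (le_trans (mdist_ge0 _ _) pD).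
  rewrite (integral_cst g measurableT (D ^+ 2)%:E).
  rewrite [leLHS](_ : _ = (D ^+ 2)%:E)//.
  by rewrite -[RHS]mule1; congr (_ * _); exact: probability_setT.
have : 0 <= W2 mu nu by exact: sqrte_ge0.
case: (W2 mu nu) => [w| |]//; first by exists w.

Qed.

Lemma CD0oo_brunn_minkowski (m : {measure set (borel X) -> \bar R}) A B
    (x0 : X) (r a b D t e : R) :
  CD0oo m -> measurable A -> measurable B ->
  A `<=` ball x0 r -> B `<=` ball x0 r ->
  (0 < a)%R -> m A = a%:E -> (0 < b)%R -> m B = b%:E ->
  (0 < t)%R -> (t < 1)%R -> (0 <= D)%R -> (t * D < e)%R ->
  (forall x z, A x -> B z -> mdist (x : X) (z : X) <= D)%R ->
  m (enlargement A e) < +oo ->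
  ((1 - t) * ln a + t * ln b <= ln (fine (m (enlargement A e))))%R.
Proof.
move=> cd mA mB Ar Br a0 mAa b0 mBb t0 t1 D0 tDe AB mZoo.
have [mu0 mu0A] := uniform_on_exists mA a0 mAa.
have [mu1 mu1B] := uniform_on_exists mB b0 mBb.
have [] := cd mu0 mu1.
- exact: (uniform_on_second_moment mA mu0A sX Ar).
- exact: (uniform_on_second_moment mB mu1B sX Br).
- exact: (uniform_on_dominates mA mu0A).
- exact: (uniform_on_dominates mB mu1B).
move=> mu_ [_ mu_0 mu_1 geo] /(_ t); rewrite (ltW t0) (ltW t1) => /(_ isT).
rewrite (uniform_on_Ent mA a0 mAa mu0A) (uniform_on_Ent mB b0 mBb mu1B).
change ((t%:E * (- ln b)%:E + (1 - t)%:E * (- ln a)%:E)%dE) with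
  ((t * (- ln b) + (1 - t) * (- ln a))%:E).
have mu0C := uniform_on_setC mA mu0A.
have mu1C := uniform_on_setC mB mu1B.
have [w Ww] := W2_finite mA mB mu0C mu1C AB.
have Zt : mu_ t (~` enlargement A e) = 0.
  apply: (@interpolant_concentration R X sX mu0 (mu_ t) mu1 A B w t D e) => //.
  - have := geo 0%R t; rewrite lexx ler01 ltW// ltW// => /(_ isT isT).
    by rewrite mu_0 Ww subr0 gtr0_norm.
  - have := geo t 1%R; rewrite lexx ler01 ltW// ltW// => /(_ isT isT).
    by rewrite mu_1 Ww gtr0_norm// subr_gt0.
rewrite /Ent; case: pselect => [h|]; last by rewrite leye_eq.
move: (sval (cid h)) (svalP (cid h)) => rho drho.
have e0 : (0 < e)%R by rewrite (le_lt_trans _ tDe)// mulr_ge0// ltW.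
have mZ : measurable (enlargement A e : set (borel X)).
  exact: measurable_enlargement.
have AZ : a%:E <= m (enlargement A e).
  rewrite -mAa le_measure ?inE//; exact: sub_enlargement.
move: AZ mZoo drho Zt.
case mZz : (m (enlargement A e)) => [z| |]//.
rewrite lee_fin => az _ drho Zt entZ.
have z0 : (0 < z)%R by rewrite (lt_le_trans a0).
have := le_trans (jensen_entropy drho mZ Zt z0 mZz) entZ.
by rewrite lee_fin /=; lra.
Qed.

End brunn_minkowski.

(** * Growth of real functions *)

Section real_growth.
Context {R : realType}.
Implicit Types (v : R -> R) (h s r e y : R).

(** The hypothesis is a weak form of concavity: slopes from 1 to s dominate, up
    to the factor (r + 1) / (r - 1), slopes from 1 to r > s. So v(r) / r converges
    to the infimum h of the slopes. *)
Lemma growth_rate v :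
  (forall s, (1 <= s -> v 1 <= v s)%R) ->
  (forall s r, (1 < s -> s < r ->
    (s - 1) * (v r - v 1) <= (r + 1) * (v s - v 1))%R) ->
  exists h, [/\ (0 <= h)%R,
    forall r, (1 < r -> h * (r - 1) <= v r - v 1)%R,
    forall d, (0 < d)%R -> exists2 s, (1 < s)%R &
      forall r, (s < r -> v r - v 1 <= (h + d) * (r + 1))%R &
    (v r / r)%R @[r --> +oo%R] --> h].
Proof.
move=> v1 vsr.
(* the slopes of v from 1 *)
pose S := [set ((v s - v 1) / (s - 1))%R | s in [set s | (1 < s)%R]].
have S0 : lbound S 0%R.
  by move=> _ [s /= s1 <-]; rewrite divr_ge0// subr_ge0 ?v1// ltW.
have hS : has_inf S.
  by split; [exists ((v 2 - v 1) / (2 - 1))%R, 2%R => //=; lra|exists 0%R].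
pose h := inf S.
have h0 : (0 <= h)%R by apply: lb_le_inf => //; exact: hS.1.
have low r : (1 < r -> h * (r - 1) <= v r - v 1)%R.
  move=> r1; rewrite -ler_pdivlMr ?subr_gt0//.
  by apply: ge_inf; [exact: hS.2|exists r].
have up d : (0 < d)%R -> exists2 s, (1 < s)%R &
    forall r, (s < r -> v r - v 1 <= (h + d) * (r + 1))%R.
  move=> d0; have [_ [s /= s1 <-]] := inf_adherent d0 hS.
  rewrite -/h ltr_pdivrMr ?subr_gt0// => sh; exists s => // r sr.
  have s10 : (0 < s - 1)%R by rewrite subr_gt0.
  rewrite -(ler_pM2l s10); apply: (le_trans (vsr s r s1 sr)).
  have r0 : (0 <= r + 1)%R by lra.
  by have := ler_wpM2l r0 (ltW sh); lra.
exists h; split => //.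
apply/cvgrPdist_le => d d0.
have d20 : (0 < d / 2)%R by rewrite divr_gt0.
have [s s1 sup] := up _ d20.
near=> r.
have r1 : (1 < r)%R by near: r; apply: nbhs_pinfty_gt; exact: num_real.
have sr : (s < r)%R by near: r; apply: nbhs_pinfty_gt; exact: num_real.
have r0 : (0 < r)%R by lra.
have k1 : ((h - v 1) / d <= r)%R by near: r; apply: nbhs_pinfty_ge; exact: num_real.
have k2 : ((v 1 + h + d / 2) / (d / 2) <= r)%R by near: r; apply: nbhs_pinfty_ge; exact: num_real.
rewrite ler_pdivrMr// in k1; rewrite ler_pdivrMr// in k2.
have -> : (h - v r / r = (h * r - v r) / r)%R by field; rewrite gt_eqF.
have ri : (0 < r^-1)%R by rewrite invr_gt0.
rewrite normrM (gtr0_norm ri) ler_pdivrMr//.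
have := low r r1; have := sup r sr; rewrite ler_norml; nra.
Unshelve. all: by end_near. Qed.

(** Since v(r) >= h r + O(1), dividing the hypothesis by r and letting r tend
    to infinity gives e h <= y. *)
Lemma rate_le v h k e rho y M : (0 < e)%R ->
  (forall r, (1 < r -> h * (r - 1) <= v r - v 1)%R) ->
  (forall r, (M < r -> e * (v r - k) <= (rho + r) * y)%R) ->
  (e * h <= y)%R.
Proof.
move=> e0 low up; rewrite leNgt; apply/negP => yh.
pose c := (rho * y + e * (h - v 1 + k))%R.
pose r := (Num.max (Num.max M 1) (c / (e * h - y)) + 1)%R.
have rM : (M < r)%R by rewrite ltr_pwDr// !le_max lexx.
have r1 : (1 < r)%R by rewrite ltr_pwDr// !le_max lexx orbT.
have rc : (c / (e * h - y) < r)%R by rewrite ltr_pwDr// !le_max lexx !orbT.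
have d0 : (0 < e * h - y)%R by rewrite subr_gt0.
rewrite ltr_pdivrMr// in rc.
have := up r rM; have := low r r1; rewrite -(ler_pM2l e0).
move: rc; rewrite /c; nra.
Qed.

(** A nondecreasing function whose right increments are locally at least C times
    the step grows at least with slope C: the supremum of the points of [1, T]
    where the bound holds satisfies the bound, and can only be T. *)
Lemma slope_growth v C :
  (0 <= C)%R -> (forall r s, (1 <= r -> r <= s -> v r <= v s)%R) ->
  (forall r, (1 <= r)%R -> exists2 d, (0 < d)%R &
    forall e, (0 < e -> e < d -> v r + C * e <= v (r + e))%R) ->
  forall r, (1 <= r -> v 1 + C * (r - 1) <= v r)%R.
Proof.
move=> C0 vmono vloc T T1.
pose S := [set r | (1 <= r)%R /\ (r <= T)%R /\ (v 1 + C * (r - 1) <= v r)%R].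
have S1 : S 1%R by rewrite /S /=; split => //; split => //; lra.
have hS : has_sup S by split; [exists 1%R|exists T => r [_ []]].
pose s := sup S.
have s1 : (1 <= s)%R by apply: ub_le_sup => //; exact: hS.2.
have sT : (s <= T)%R by apply: ge_sup; [exists 1%R|move=> r [_ []]].
have vs : (v 1 + C * (s - 1) <= v s)%R.
  apply/ler_addgt0Pr => e e0.
  pose d := (e / (C + 1))%R.
  have d0 : (0 < d)%R by rewrite divr_gt0// ltr_wpDl.
  have [r [r1 [rT vr]] sr] := sup_adherent d0 hS.
  have rs : (r <= s)%R by apply: ub_le_sup; [exact: hS.2|].
  have := vmono r s r1 rs; rewrite -/s in sr.
  have dE : (d * (C + 1) = e)%R by rewrite /d divfK// gt_eqF// ltr_wpDl.
  have Csr : (0 <= C * (r - (s - d)))%R by rewrite mulr_ge0// subr_ge0 ltW.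
  lra.
move: sT; rewrite le_eqVlt => /predU1P[<-//|sT].
have [d d0 vd] := vloc s s1.
pose e := (Num.min (d / 2) (T - s))%R.
have e0 : (0 < e)%R by rewrite lt_min divr_gt0//= subr_gt0.
have ed : (e < d)%R by rewrite gt_min; apply/orP; left; lra.
have eT : (e <= T - s)%R by rewrite ge_min lexx orbT.
have : S (s + e)%R.
  split; first by lra.
  split; first by lra.
  by have := vd e e0 ed; nra.
move=> Se; have : (s + e <= s)%R by apply: ub_le_sup; [exact: hS.2|].
lra.
Qed.

Lemma ln1D_ge (C C' e : R) : (0 < C')%R -> (C' < C)%R -> (0 < e)%R ->
  (e < (C - C') / (C * C'))%R -> (C' * e <= ln (1 + C * e))%R.
Proof.
move=> C'0 CC' e0; have C0 : (0 < C)%R by lra.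
rewrite ltr_pdivlMr ?mulr_gt0// => eC.
have Ce : (0 < 1 + C * e)%R by rewrite ltr_wpDl// mulr_gt0.
rewrite -lerN2 -lnV ?posrE//.
have -> : ((1 + C * e)^-1 = 1 + ((1 + C * e)^-1 - 1))%R by lra.
apply: (le_trans (le_ln1Dx _)).
  by rewrite ltrBrDr addNr invr_gt0.
rewrite lerBlDr -(ler_pM2r Ce) mulVf ?gt_eqF//.
by move: eC; rewrite -(ltr_pM2l e0); lra.
Qed.

End real_growth.

(** * Growth of balls and the isoperimetric inequality *)

Section ball_growth.
Context {R : realType} (X : completeMetricType R).
Variables (m : {measure set (borel X) -> \bar R}) (x0 : X).
Hypothesis mms : is_metric_measure_space m.
Hypothesis cd : CD0oo m.
Implicit Types (r s e : R) (A Z : set (borel X)).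

(** The logarithm of the mass of the ball of centre [x0] and radius r. The mass is
    finite, so [fine] loses no information, and it is positive for r > 0. *)
Definition log_ball_mass r : R := ln (fine (m (ball x0 r))).

Local Notation v := log_ball_mass.

Lemma ball_mass_gt0 r : (0 < r)%R -> (0 < fine (m (ball x0 r)))%R.
Proof.
move=> r0; have [_ fsupp bfin] := mms; apply: fine_gt0; apply/andP; split.
  by apply: fsupp; [exact: open_mball|exists x0; exact: ballxx].
by apply: bfin; [exact: measurable_mball|exists x0, r].
Qed.

Lemma bounded_mass_lty A r : measurable A -> A `<=` ball x0 r -> m A < +oo.
Proof. by move=> mA Ar; have [_ _ bfin] := mms; apply: bfin => //; exists x0, r. Qed.

Lemma ball_massE r : m (ball x0 r) = (fine (m (ball x0 r)))%:E.
Proof.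
rewrite fineK// ge0_fin_numE//.
by apply: (@bounded_mass_lty _ r) => //; exact: measurable_mball.
Qed.

Lemma log_ball_mass_mono r s : (0 < r)%R -> (r <= s)%R -> (v r <= v s)%R.
Proof.
move=> r0 rs; rewrite /log_ball_mass ler_ln ?posrE ?ball_mass_gt0//.
  rewrite -lee_fin -!ball_massE le_measure ?inE//; try exact: measurable_mball.
  exact: le_ball.
exact: lt_le_trans rs.
Qed.

(** The Brunn-Minkowski inequality between A and a large ball, in the limit
    t -> e / (rho + r), where rho + r bounds the distances involved. *)
Lemma brunn_minkowski_ball A (rho a e r : R) : measurable A ->
  (0 < rho)%R -> A `<=` ball x0 rho -> (0 < a)%R -> m A = a%:E ->
  (0 < e)%R -> (e < r)%R ->
  (e * (v r - ln a) <=
    (rho + r) * (ln (fine (m (enlargement A e))) - ln a))%R.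
Proof.
move=> mA rho0 Arho a0 mAa e0 er.
have r0 : (0 < r)%R by exact: lt_trans er.
pose L := (rho + r)%R; have L0 : (0 < L)%R by rewrite addr_gt0.
set z := fine (m (enlargement A e)).
have mZoo : m (enlargement A e) < +oo.
  apply: (@bounded_mass_lty _ (rho + e)%R); first exact: measurable_enlargement.
  exact: subset_trans (enlargementS Arho) (@enlargement_mball _ _ _ _ _).
have az : (a <= z)%R.
  rewrite /z -lee_fin fineK ?ge0_fin_numE// -mAa le_measure ?inE//.
    exact: measurable_enlargement.
  exact: sub_enlargement.
have y0 : (0 <= ln z - ln a)%R.
  by rewrite subr_ge0 ler_ln ?posrE// (lt_le_trans a0).
have AB x y : A x -> ball x0 r y -> (mdist (x : X) y <= L)%R.
  move=> /Arho; rewrite !mem_ballE => x0x x0y.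
  by rewrite (le_trans (metric_triangle x x0 y))// metric_sym lerD// ltW.
have key t : (0 < t)%R -> (t * L < e)%R ->
    (t * (v r - ln a) <= ln z - ln a)%R.
  move=> t0 tL; have t1 : (t < 1)%R.
    rewrite -(ltr_pM2r L0) mul1r (lt_trans tL)// (lt_trans er)//.
    by rewrite /L ltrDr.
  have big : ball x0 r `<=` ball x0 L by apply: le_ball; rewrite lerDr ltW.
  have ArL : A `<=` ball x0 L.
    by apply: (subset_trans Arho); apply: le_ball; rewrite lerDl ltW.
  have [sX _ _] := mms.
  have := CD0oo_brunn_minkowski sX cd mA (measurable_mball x0 r) ArL big a0 mAa
    (ball_mass_gt0 r0) (ball_massE r) t0 t1 (ltW L0) tL AB mZoo.
  by rewrite -/z -/(v r); lra.
(* the strict bounds for [t < e / L] pass to the limit [t = e / L] *)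
rewrite -ler_pdivrMl// mulrA leNgt; apply/negP => yq.
have q0 : (0 < v r - ln a)%R.
  have := le_lt_trans y0 yq; rewrite pmulr_rgt0// mulr_gt0// invr_gt0//.
pose t := (((ln z - ln a) / (v r - ln a) + L^-1 * e) / 2)%R.
have yq' : ((ln z - ln a) / (v r - ln a) < L^-1 * e)%R by rewrite ltr_pdivrMr.
have Le0 : (0 < L^-1 * e)%R by rewrite mulr_gt0// invr_gt0.
have yq0 : (0 <= (ln z - ln a) / (v r - ln a))%R by rewrite divr_ge0// ltW.
have t0 : (0 < t)%R by rewrite /t; lra.
have tL : (t * L < e)%R.
  by rewrite -ltr_pdivlMr// mulrC /t; lra.
have := key t t0 tL; rewrite leNgt => /negP; apply.
by rewrite -ltr_pdivrMr// /t; lra.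
Qed.

(** The previous lemma for the unit ball, whose enlargements lie in concentric
    balls, is the weak concavity required by [growth_rate]. *)
Lemma ball_growth_rate : exists h, [/\ (0 <= h)%R,
    forall r, (1 < r -> h * (r - 1) <= v r - v 1)%R,
    forall d, (0 < d)%R -> exists2 s, (1 < s)%R &
      forall r, (s < r -> v r - v 1 <= (h + d) * (r + 1))%R &
    (v r / r)%R @[r --> +oo%R] --> h].
Proof.
apply: growth_rate => [s s1|s r s1 sr]; first exact: log_ball_mass_mono.
have s0 : (0 < s - 1)%R by rewrite subr_gt0.
have sr' : (s - 1 < r)%R by lra.
have := @brunn_minkowski_ball (ball x0 1%R) 1%R _ (s - 1)%R r
  (measurable_mball x0 1) ltr01 (@subset_refl _ _) (ball_mass_gt0 ltr01)
  (ball_massE 1) s0 sr'.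
rewrite -/(v 1) => /le_trans; apply.
rewrite addrC ler_pM2l; last by lra.
rewrite lerD2r /log_ball_mass.
have sub : enlargement (ball x0 1) (s - 1) `<=` ball x0 s.
  by move=> x /enlargement_mball; rewrite addrC subrK.
have mE := measurable_enlargement (ball x0 1%R) (s - 1)%R.
have zE : m (enlargement (ball x0 1%R) (s - 1)%R) \is a fin_num.
  by rewrite ge0_fin_numE//; exact: bounded_mass_lty sub.
have s1' : (0 < s)%R by lra.
have mB1 := measurable_mball x0 1%R; have mBs := measurable_mball x0 s.
have z0 : (0 < fine (m (enlargement (ball x0 1%R) (s - 1)%R)))%R.
  apply: (lt_le_trans (ball_mass_gt0 ltr01)).
  by rewrite -lee_fin -ball_massE fineK// le_measure ?inE//; exact: sub_enlargement.
rewrite ler_ln ?posrE ?ball_mass_gt0//.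
by rewrite -lee_fin -ball_massE fineK// le_measure ?inE.
Qed.

Lemma volume_entropyE h : (v r / r)%R @[r --> +oo%R] --> h ->
  volume_entropy m x0 = h%:E.
Proof.
move=> vh; apply: cvg_lim => //.
have : ((v r / r)%R)%:E @[r --> +oo%R] --> h%:E.
  by apply: cvg_EFin => //; exact: nearW.
apply: cvg_trans; apply: near_eq_cvg; near=> r.
have r0 : (0 < r)%R by near: r; apply: nbhs_pinfty_gt; exact: num_real.
by rewrite ball_massE lne_EFin ?ball_mass_gt0// inver gt_eqF.
Unshelve. all: by end_near. Qed.

Section lower_bound.
Variable h : R.
Hypothesis h0 : (0 <= h)%R.
Hypothesis low : forall r, (1 < r -> h * (r - 1) <= v r - v 1)%R.

Let bounded_enlargement_growth A (rho e : R) : measurable A ->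
  (0 < rho)%R -> A `<=` ball x0 rho -> (0 < e)%R ->
  (1 + e * h)%:E * m A <= m (enlargement A e).
Proof.
move=> mA rho0 Arho e0.
have mZ := measurable_enlargement A e.
have : 0 <= m A by [].
rewrite le_eqVlt => /predU1P[<-|mA0]; first by rewrite mule0.
have mZoo : m (enlargement A e) < +oo.
  apply: (@bounded_mass_lty _ (rho + e)%R) => //.
  exact: subset_trans (enlargementS Arho) (@enlargement_mball _ _ _ _ _).
have mAoo := bounded_mass_lty mA Arho.
have mAa : m A = (fine (m A))%:E by rewrite fineK// ge0_fin_numE.
have a0 : (0 < fine (m A))%R by rewrite fine_gt0// mA0.
move: mAa a0; set a := fine (m A) => mAa a0.
have mZz : m (enlargement A e) = (fine (m (enlargement A e)))%:E.
  by rewrite fineK// ge0_fin_numE.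
have az : a%:E <= m (enlargement A e).
  by rewrite -mAa le_measure ?inE//; exact: sub_enlargement.
have key r : (e < r)%R -> (e * (v r - ln a) <=
    (rho + r) * (ln (fine (m (enlargement A e))) - ln a))%R.
  exact: brunn_minkowski_ball.
move: mZz az key; set z := fine _ => -> az key; rewrite lee_fin in az.
have z0 : (0 < z)%R by rewrite (lt_le_trans a0).
have eh : (e * h <= ln z - ln a)%R by exact: rate_le e0 low key.
have eh1 : (0 < 1 + e * h)%R by rewrite ltr_pwDl// mulr_ge0// ltW.
rewrite mAa -EFinM lee_fin -ler_ln ?posrE ?mulr_gt0// lnM ?posrE//.
rewrite -lerBrDr (le_trans _ eh)// le_ln1Dx// (lt_le_trans (ltrN10 R))//.
by rewrite mulr_ge0// ltW.
Qed.

(** The linear factor 1 + e h <= exp (e h) is enough for the Minkowski content;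
    A may be unbounded and of infinite mass. *)
Lemma enlargement_growth A e : measurable A -> (0 < e)%R ->
  (1 + e * h)%:E * m A <= m (enlargement A e).
Proof.
move=> mA e0; pose F (n : nat) : set (borel X) := A `&` ball x0 n.+1%:R.
have mF n : measurable (F n) by apply: measurableI => //; exact: measurable_mball.
have UF : \bigcup_n F n = A.
  apply/seteqP; split => [x [n _ []]//|x Ax].
  exists (Num.truncn (mdist x0 x)) => //; split => //; rewrite mem_ballE.
  by rewrite truncnS_gt.
have ndF : nondecreasing_seq F.
  move=> n k nk; apply/subsetPset; apply: setIS; apply: le_ball.
  by rewrite ler_nat ltnS.
have mUF : measurable (\bigcup_n F n) by rewrite UF.
have FA := nondecreasing_cvg_mu (mu := m) mF mUF ndF; rewrite UF in FA.
have : (1 + e * h)%:E * (m \o F) n @[n --> \oo] --> (1 + e * h)%:E * m A.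
  exact: cvgeZl.
move=> /cvge_to_le; apply; apply: nearW => n /=.
apply: (@le_trans _ _ (m (enlargement (F n) e))).
  apply: (@bounded_enlargement_growth _ n.+1%:R) => //; exact: subIsetr.
by rewrite le_measure ?inE//; try exact: measurable_enlargement;
  apply: enlargementS; exact: subIsetl.
Qed.

Lemma minkowski_content_ge A : measurable A -> m A < +oo ->
  m A * h%:E <= minkowski_content m A.
Proof.
move=> mA mAoo; rewrite /minkowski_content limf_einfE.
apply: le_ereal_sup_tmp.
exists (ereal_inf [set (m (enlargement A e) - m A) / e%:E |
  e in [set e : R | (0 < e)%R]]).
  by exists [set e : R | (0 < e)%R] => //; exact: nbhs_right_gt.
apply: le_ereal_inf_tmp => _ [e /= e0 <-].
have := enlargement_growth mA e0.
have mAa : m A = (fine (m A))%:E by rewrite fineK// ge0_fin_numE.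
rewrite inver gt_eqF// mAa -!EFinM.
have a0 : (0 <= fine (m A))%R by exact: fine_ge0.
case: (m (enlargement A e)) => [z| |]//.
- rewrite -EFinB -EFinM !lee_fin => az.
  by rewrite ler_pdivlMr//; lra.
- by move=> _; rewrite addye// gt0_mulye ?leey// lte_fin invr_gt0.
Qed.

End lower_bound.

End ball_growth.

(** * Sharpness of the constant *)

Section sharpness.
Context {R : realType} (X : completeMetricType R).
Variables (m : {measure set (borel X) -> \bar R}) (x0 : X).
Hypothesis mms : is_metric_measure_space m.
Implicit Types (r s e : R).

Local Notation v := (log_ball_mass m x0).

Lemma minkowski_content_ball_growth (C C' r : R) : (C' < C)%R -> (0 < r)%R ->
  C%:E * m (ball x0 r) <= minkowski_content m (ball x0 r) ->
  exists2 d, (0 < d)%R & forall e, (0 < e)%R -> (e < d)%R ->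
    ((1 + C' * e) * fine (m (ball x0 r)) <= fine (m (ball x0 (r + e))))%R.
Proof.
move=> CC' r0; have V0 := ball_mass_gt0 x0 mms r0.
rewrite {1}(ball_massE x0 mms) -EFinM => VC.
have {VC} : (C' * fine (m (ball x0 r)))%:E < minkowski_content m (ball x0 r).
  by apply: lt_le_trans VC; rewrite lte_fin ltr_pM2r.
rewrite /minkowski_content limf_einfE => /ereal_sup_gt[_ [E E0 <-] CE].
have /nbhs_ballP[d /= d0 dE] : nbhs (0 : R)%R [set e | (0 < e)%R -> E e] by [].
exists d => // e e0 ed.
have /dE Ee : ball (0 : R)%R d e by rewrite /ball /= sub0r normrN gtr0_norm.
have := lt_le_trans CE (ereal_inf_lbound (imageP _ (Ee e0))).
set Z := enlargement _ _.
have ZB : m Z <= m (ball x0 (r + e)%R).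
  rewrite le_measure ?inE//; first exact: measurable_enlargement.
    exact: measurable_mball.
  exact: enlargement_mball.
move: ZB; rewrite (ball_massE x0 mms (r + e)) (ball_massE x0 mms r).
rewrite inver gt_eqF//; have : 0 <= m Z by [].
case: (m Z) => [z| |]//; rewrite !lee_fin => _ zV.
rewrite -EFinB -EFinM lte_fin ltr_pdivlMr// => lt.
by apply: le_trans zV; lra.
Qed.

(** An isoperimetric inequality for balls with constant C forces exponential
    growth of their mass at every rate C' < C. *)
Lemma minkowski_content_ball_lower (C C' : R) : (0 < C')%R -> (C' < C)%R ->
  (forall r, (0 < r)%R ->
    C%:E * m (ball x0 r) <= minkowski_content m (ball x0 r)) ->
  forall r, (1 <= r -> v 1 + C' * (r - 1) <= v r)%R.
Proof.
move=> C'0 CC' isoC.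
pose C1 := ((C + C') / 2)%R.
have C1C : (C1 < C)%R by rewrite /C1; lra.
have C'C1 : (C' < C1)%R by rewrite /C1; lra.
apply: slope_growth; first exact: ltW.
  by move=> r s r1; apply: log_ball_mass_mono => //; lra.
move=> r r1; have r0 : (0 < r)%R by lra.
have [d d0 dP] := minkowski_content_ball_growth C1C r0 (isoC r r0).
pose d' := ((C1 - C') / (C1 * C'))%R.
have d'0 : (0 < d')%R by rewrite divr_gt0 ?mulr_gt0 ?subr_gt0//; lra.
exists (Num.min d d'); first by rewrite lt_min d0.
move=> e e0; rewrite lt_min => /andP[ed ed'].
have V0 := ball_mass_gt0 x0 mms r0.
have C1e : (0 < 1 + C1 * e)%R by rewrite ltr_wpDl// mulr_gt0//; lra.
apply: (@le_trans _ _ (ln ((1 + C1 * e) * fine (m (ball x0 r)))%R)).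
  by rewrite lnM ?posrE// addrC lerD2r; exact: ln1D_ge.
rewrite ler_ln ?posrE ?mulr_gt0//; first exact: dP.
by apply: ball_mass_gt0 => //; lra.
Qed.

End sharpness.

Theorem theorem1p3 (R : realType) (X : completeMetricType R)
    (m : {measure set (borel X) -> \bar R})
    (mms : is_metric_measure_space m) (cd : CD0oo m) (x0 : X) :
  let h := volume_entropy m x0 in
  (forall Omega : set (borel X), measurable Omega -> m Omega < +oo ->
     m Omega * h <= minkowski_content m Omega) /\
  (forall C : R, h < C%:E ->
     ~ (forall Omega : set (borel X), measurable Omega -> m Omega < +oo ->
          C%:E * m Omega <= minkowski_content m Omega)).
Proof.
have [h [h0 low up vh]] := ball_growth_rate x0 mms cd.
move=> /=; rewrite (volume_entropyE mms vh); split.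
  by move=> A mA mAoo; exact: (minkowski_content_ge mms cd h0 low mA mAoo).
move=> C; rewrite lte_fin => hC isoC.
pose C' := ((h + C) / 2)%R; pose d := ((C' - h) / 2)%R.
have C'0 : (0 < C')%R by rewrite /C'; lra.
have C'C : (C' < C)%R by rewrite /C'; lra.
have d0 : (0 < d)%R by rewrite /d /C'; lra.
have vC : forall r, (1 <= r ->
    log_ball_mass m x0 1 + C' * (r - 1) <= log_ball_mass m x0 r)%R.
  apply: (minkowski_content_ball_lower mms C'0 C'C) => r r0.
  apply: isoC; first exact: measurable_mball.
  exact: (bounded_mass_lty mms (measurable_mball x0 r) (@subset_refl _ _)).
have [s s1 sP] := up d d0.
(* [C' (r - 1) <= (h + d) (r + 1)] fails for large [r] since [h + d < C'] *)
pose r := (Num.max s ((C' + (h + d)) / d) + 1)%R.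
have sr : (s < r)%R by rewrite ltr_pwDr// le_max lexx.
have kr : ((C' + (h + d)) / d < r)%R by rewrite ltr_pwDr// le_max lexx orbT.
rewrite ltr_pdivrMr// in kr.
have := vC r (ltW (lt_trans s1 sr)); have := sP r sr.
have dE : (C' - (h + d) = d)%R by rewrite /d; lra.
have : (r * d = r * (C' - (h + d)))%R by rewrite dE.
lra.
Qed.
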